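(* Every longest cycle of a $2$-connected $\{P_4,W\}$-free graph is a dominating cycle of that graph.
   Context: All graphs are finite and simple. A cycle $C$ in a graph $G$ is dominating if every edge of $G$ has at least one end vertex on $C$. $G$ is $\{P_4,W\}$-free if it contains neither $P_4$ (the path on $4$ vertices) nor $W$ as an induced subgraph, where $W=K_1+3K_2$ is the graph consisting of a vertex joined to all six vertices of three pairwise disjoint edges. *)

(* Defs.v *)
(* A finite simple graph is a symmetric irreflexive relation e : rel T
   (adjacency) on a finType T of vertices. *)
From mathcomp Require Import all_boot.

Set Implicit Arguments.
Unset Strict Implicit.
Unset Printing Implicit Defensive.

Definition simple_graph (T : finType) (e : rel T) : Prop :=
  symmetric e /\ irreflexive e.

Definition delete_vertices (T : finType) (e : rel T) (X : {set T}) : rel T :=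
  fun x y => [&& x \notin X, y \notin X & e x y].

Definition k_connected (k : nat) (T : finType) (e : rel T) : Prop :=
  k < #|T| /\
  forall X : {set T}, #|X| < k ->
  forall x y : T, x \notin X -> y \notin X ->
    connect (delete_vertices e X) x y.

Definition has_induced (S : finType) (h : rel S) (T : finType) (e : rel T) :
    Prop :=
  exists f : S -> T, injective f /\ forall x y : S, e (f x) (f y) = h x y.

Definition induced_free (S : finType) (h : rel S) (T : finType) (e : rel T) :
    Prop :=
  ~ has_induced h e.

Definition path_graph (n : nat) : rel 'I_n :=
  fun i j => (i.+1 == j) || (j.+1 == i).
Arguments path_graph n : clear implicits.

Definition complete_graph (n : nat) : rel 'I_n := fun i j => i != j.
Arguments complete_graph n : clear implicits.

(* The graph mH. *)
Definition copies (m : nat) (S : finType) (h : rel S) : rel ('I_m * S) :=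
  fun p q => (p.1 == q.1) && h p.2 q.2.
Arguments copies m {S} h.

(* The graph G + H, where + is the join and not the disjoint union. *)
Definition join_graph (S U : finType) (g : rel S) (h : rel U) : rel (S + U) :=
  fun a b => match a, b with
             | inl x, inl y => g x y
             | inr x, inr y => h x y
             | _, _ => true
             end.

Definition P4 : rel 'I_4 := path_graph 4.

Definition W : rel ('I_1 + 'I_3 * 'I_2) :=
  join_graph (complete_graph 1) (copies 3 (complete_graph 2)).

(* A cycle is given by the cyclic sequence of its distinct vertices; there
   must be at least three, as [:: x; y] satisfies ucycle as soon as xy is an
   edge. *)
Definition is_cycle (T : finType) (e : rel T) (C : seq T) : Prop :=
  2 < size C /\ ucycle e C.

Definition longest_cycle (T : finType) (e : rel T) (C : seq T) : Prop :=
  is_cycle e C /\ forall D : seq T, is_cycle e D -> size D <= size C.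

Definition dominating_cycle (T : finType) (e : rel T) (C : seq T) : Prop :=
  is_cycle e C /\ forall x y : T, e x y -> x \in C \/ y \in C.

(* Main.v *)
(* Let [x y] be an edge missing the longest cycle [C], and for [v] on [C] write
   [v1], [v2] for its first and second successors.  If [v] is adjacent to [x],
   then it is adjacent to [y], since otherwise [v1 v x y] is an induced P4.
   Hence neighbourhoods on [C] are constant along paths outside [C], and
   2-connectedness yields two vertices [v], [w] of [C] adjacent to both [x] and
   [y].  Maximality of [C] and P4-freeness make the edges [x y], [v1 v2] and
   [w1 w2] induce 3K2, and P4-freeness makes [v] or [w] adjacent to all six of
   their ends: this is an induced W. *)
Require Import Defs.
From mathcomp Require Import all_boot zify.

Set Implicit Arguments.
Unset Strict Implicit.
Unset Printing Implicit Defensive.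

(** * Induced copies of [P4] and [W] *)

(** Vertices with equal images have equal rows in [h], so in a twin-free pattern injectivity comes
    for free from the adjacency check. *)
Lemma twin_free_induced (S T : finType) (h : rel S) (e : rel T) (f : S -> T) :
  (forall i j, (forall k, h i k = h j k) -> i = j) ->
  (forall i j, e (f i) (f j) = h i j) -> has_induced h e.
Proof.
move=> twin_free fE; exists f; split=> // i j fij.
by apply: twin_free => k; rewrite -!fE fij.
Qed.

Lemma P4_twin_free (i j : 'I_4) : (forall k, P4 i k = P4 j k) -> i = j.
Proof.
move=> twin; apply/eqP; move: (twin (inord 0)) (twin (inord 1)).
move: (twin (inord 2)) (twin (inord 3)); rewrite /P4 /path_graph !inordK //.
by move: i j {twin} => [[|[|[|[|i]]]] ilt] [[|[|[|[|j]]]] jlt].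
Qed.

Lemma W_twin_free i j : (forall k, W i k = W j k) -> i = j.
Proof.
case: i j => [a|[i a]] [b|[j b]] twin.
- by rewrite (ord1 a) (ord1 b).
- by have := twin (inl a); rewrite /= /complete_graph eqxx.
- by have := twin (inl b); rewrite /= /complete_graph eqxx.
(* The test vertex is the other end of the edge at [(i, a)]; being adjacent to [(j, b)] as well, it
   forces [j = i] and then [b = a]. *)
- have := twin (inr (i, rev_ord a)).
  rewrite /= /copies /complete_graph /= eqxx /=.
  have -> : a != rev_ord a by case: a {twin} => [[|[|a]] alt].
  move/esym/andP => [/eqP <- nb]; congr (inr (_, _)); apply/eqP.
  by move: a b nb {twin} => [[|[|a]] alt] [[|[|b]] blt].
Qed.

Lemma P4_free_path (T : finType) (e : rel T) (a b c d : T) :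
  simple_graph e -> induced_free P4 e ->
  e a b -> e b c -> e c d -> ~~ e a c -> ~~ e b d -> e a d.
Proof.
move=> [sym irr] free ab bc cd ac bd; apply/negPn/negP => ad; apply: free.
apply: (twin_free_induced (f := fun i : 'I_4 => nth a [:: a; b; c; d] i)).
  exact: P4_twin_free.
move: (ab) (bc) (cd) (ac) (bd) (ad); rewrite sym => ba.
rewrite sym => cb; rewrite sym => dc; rewrite sym => ca.
rewrite sym => db; rewrite sym => da.
by move=> [[|[|[|[|i]]]] ilt] [[|[|[|[|j]]]] jlt] //=;
  rewrite ?irr ?ab ?ba ?bc ?cb ?cd ?dc ?(negPf ac) ?(negPf ca)
    ?(negPf bd) ?(negPf db) ?(negPf ad) ?(negPf da).
Qed.

Lemma W_induced (T : finType) (e : rel T) (v a1 a2 b1 b2 c1 c2 : T) :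
  simple_graph e -> all (e v) [:: a1; a2; b1; b2; c1; c2] ->
  e a1 a2 -> e b1 b2 -> e c1 c2 ->
  ~~ has (e a1) [:: b1; b2; c1; c2] -> ~~ has (e a2) [:: b1; b2; c1; c2] ->
  ~~ has (e b1) [:: c1; c2] -> ~~ has (e b2) [:: c1; c2] ->
  has_induced W e.
Proof.
move=> [sym irr] vN aa bb cc.
rewrite -!all_predC => a1N a2N b1N b2N.
pose s := [:: a1; a2; b1; b2; c1; c2].
(* The ends of the [i]-th edge sit at positions [2i] and [2i + 1] of [s]. *)
apply: (twin_free_induced (f := fun p : 'I_1 + 'I_3 * 'I_2 => match p with
  | inl _ => v | inr q => nth v s (q.1.*2 + q.2) end)).
  exact: W_twin_free.
have symE a b c : e a b = c -> (e a b = c) * (e b a = c).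
  by move=> <-; rewrite [e b a]sym.
move: vN a1N a2N b1N b2N; rewrite /= !andbT.
move=> /and5P[/symE va1 /symE va2 /symE vb1 /symE vb2 /andP[/symE vc1 /symE vc2]].
move=> /and4P[/negPf/symE n1 /negPf/symE n2 /negPf/symE n3 /negPf/symE n4].
move=> /and4P[/negPf/symE n5 /negPf/symE n6 /negPf/symE n7 /negPf/symE n8].
move=> /andP[/negPf/symE n9 /negPf/symE n10].
move=> /andP[/negPf/symE n11 /negPf/symE n12].
move: aa bb cc => /symE aa /symE bb /symE cc.
move=> [i|[[[|[|[|i]]] ilt] [[|[|k]] klt]]] [j|[[[|[|[|j]]] jlt] [[|[|l]] llt]]] //=;
  rewrite ?(ord1 i) ?(ord1 j) ?irr /complete_graph /copies /s /=
    ?va1 ?va2 ?vb1 ?vb2 ?vc1 ?vc2 ?n1 ?n2 ?n3 ?n4 ?n5 ?n6 ?n7 ?n8 ?n9 ?n10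
    ?n11 ?n12 ?aa ?bb ?cc ?eqxx //.
Qed.

(** * Exchange arguments on a longest cycle *)

(** Without the bound on the length, an exchange argument only has to exhibit a longer [ucycle]. *)
Definition max_cycle (T : finType) (e : rel T) (C : seq T) : Prop :=
  ucycle e C /\ forall D, ucycle e D -> size D <= size C.

Lemma max_cycle_rot (T : finType) (e : rel T) i (C : seq T) :
  max_cycle e C -> max_cycle e (rot i C).
Proof.
by case=> C_cycle C_max; split=> [|D]; rewrite ?rot_ucycle // size_rot; apply: C_max.
Qed.

Lemma longest_max_cycle (T : finType) (e : rel T) (C : seq T) :
  longest_cycle e C -> max_cycle e C.
Proof.
case=> -[C3 C_cycle] C_max; split=> // D D_cycle.
case: (ltnP 2 (size D)) => [D3|]; first exact: C_max.
by move/leq_trans; apply; apply: ltnW.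
Qed.

(** Otherwise [x] could be inserted between [v] and [v1]. *)
Lemma next_nonadj (T : finType) (e : rel T) (v v1 x : T) (p : seq T) :
  symmetric e -> max_cycle e [:: v, v1 & p] ->
  x \notin [:: v, v1 & p] -> e v x -> ~~ e v1 x.
Proof.
move=> sym [/andP[C_cycle C_uniq] C_max] xC vx; apply/negP => v1x.
have /C_max : ucycle e [:: v, x, v1 & p]; last by rewrite /= ltnn.
move: C_cycle C_uniq xC; rewrite /ucycle /= vx (sym x) v1x !inE.
by move=> /andP[_ ->] /andP[/negPf -> ->]; rewrite eq_sym negb_or
  => /andP[/negPf -> ->].
Qed.

(** Otherwise replacing [v1] by [y, x] would lengthen the cycle. *)
Lemma next2_nonadj (T : finType) (e : rel T) (v v1 v2 : T) (p : seq T)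
    (x y : T) :
  symmetric e -> irreflexive e -> max_cycle e [:: v, v1, v2 & p] ->
  x \notin [:: v, v1, v2 & p] -> y \notin [:: v, v1, v2 & p] ->
  e x y -> e v y -> ~~ e v2 x.
Proof.
move=> sym irr [/andP[C_cycle C_uniq] C_max] xC yC xy vy; apply/negP => v2x.
have /C_max : ucycle e [:: v, y, x, v2 & p]; last by rewrite /= ltnn.
have yx : y == x = false by apply/eqP=> yx; rewrite yx irr in xy.
move: C_cycle C_uniq xC yC; rewrite /ucycle /= vy (sym x) v2x (sym y) xy !inE.
move=> /and3P[_ _ ->] /and3P[]; rewrite !negb_or => /and3P[_ -> ->] _ ->.
move=> /and4P[xv _ -> ->] /and4P[yv _ -> ->].
by rewrite yx (eq_sym v y) (eq_sym v x) xv yv.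
Qed.

(* Rerouting through the chord [a b] inserts [x] and [y] and loses only the
   vertices of [p] and [q]. *)
Lemma cross_nonadj (T : finType) (e : rel T) (v w a b x y : T)
    (p q s t : seq T) :
  symmetric e -> irreflexive e ->
  max_cycle e ([:: v] ++ p ++ a :: s ++ [:: w] ++ q ++ b :: t) ->
  x \notin ([:: v] ++ p ++ a :: s ++ [:: w] ++ q ++ b :: t) ->
  y \notin ([:: v] ++ p ++ a :: s ++ [:: w] ++ q ++ b :: t) ->
  e x y -> e v x -> e w y -> size p + size q < 2 -> ~~ e a b.
Proof.
move=> sym irr; set C := [:: v] ++ _ => -[/andP[C_cycle C_uniq] C_max].
move=> xC yC xy vx wy size_pq; apply/negP => ab.
pose D := [:: v; x; y; w] ++ rev (a :: s) ++ b :: t.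
have [paw pbv] : path e a (rcons s w) /\ path e b (rcons t v).
  move: C_cycle; rewrite /C /= rcons_cat cat_path /= => /and3P[_ _].
  rewrite rcons_cat cat_path /= rcons_cat cat_path /= => /and5P[as_path sw _ _ ->].
  by rewrite rcons_path as_path sw.
(* This one permutation gives both that [D] has no repetition and that its length is [size C + 2]
   minus the lengths of [p] and [q]. *)
have D_perm : perm_eq (D ++ (p ++ q)) [:: x, y & C].
  apply/permP => P; rewrite /D /C /=.
  rewrite !(count_cat, count_rev) /= !count_cat /= count_cat /=.
  move: (nat_of_bool _) (nat_of_bool _) (nat_of_bool _) (nat_of_bool _).
  move: (nat_of_bool _) (nat_of_bool _) (count P p) (count P q) (count P s).
  move: (count P t); clear; lia.
have /C_max : ucycle e D.
  apply/andP; split.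
    rewrite /D /= vx xy (sym y) wy /= rcons_cat cat_path.
    have -> : last w (rev (a :: s)) = a by rewrite rev_cons last_rcons.
    rewrite /= ab pbv !andbT.
    have := rev_path e a (rcons s w).
    rewrite last_rcons belast_rcons => ->.
    by rewrite (eq_path (e' := e)) // => z1 z2; apply: sym.
  have : uniq (D ++ (p ++ q)).
    rewrite (perm_uniq D_perm) (cons_uniq _ (_ :: C)) (cons_uniq _ C) inE negb_or xC yC C_uniq !andbT.
    by apply/eqP=> yx; rewrite yx irr in xy.
  by rewrite cat_uniq => /andP[].
have := perm_size D_perm; rewrite size_cat (size_cat p) -[RHS]/(size C).+2.
by move: size_pq; clear; lia.
Qed.

(** * Attachments of the missed edge to the cycle *)

(** If [v] missed [y], P4-freeness on [v1 v x y] would give the edge [v1 y], and [x, y] could be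
    inserted between [v] and [v1]. *)
Lemma off_cycle_nbr (T : finType) (e : rel T) (C : seq T) (v x y : T) :
  simple_graph e -> induced_free P4 e -> max_cycle e C -> 1 < size C ->
  x \notin C -> y \notin C -> e x y -> v \in C -> e v x -> e v y.
Proof.
move=> e_simple free C_max C2 xC yC xy vC vx.
have [sym irr] := e_simple.
have [i [|v1 p] rotC] := rot_to vC; first by move: C2; rewrite -(size_rot i) rotC.
have := max_cycle_rot i C_max; rewrite rotC => C'_max.
move: xC yC; rewrite -!(mem_rot i C) rotC => xC yC.
apply/negPn/negP => vy.
have v1v : e v1 v by case: C'_max => /andP[/= /andP[]]; rewrite sym.
have v1x := next_nonadj sym C'_max xC vx.
have v1y := P4_free_path e_simple free v1v vx xy v1x vy.
have /C'_max.2 : ucycle e [:: v, x, y, v1 & p]; last by rewrite /= ltnNge ltnW.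
have yx : x == y = false by apply/eqP=> yx; rewrite yx irr in xy.
case: C'_max => /andP[/= /andP[_ C_path] /and3P[vp v1p C_uniq]] _.
move: vp xC yC; rewrite /ucycle /= vx xy (sym y) v1y C_path v1p C_uniq !inE.
rewrite !negb_or (eq_sym v x) (eq_sym v y) yx.
by move=> /andP[-> ->] /and3P[-> -> ->] /and3P[-> -> ->].
Qed.

(** Deleting [z] leaves a path from [x] to the rest of [C]. Its first vertex on [C] is adjacent to
    the one before it, and [off_cycle_nbr] carries this adjacency back along the path to [x]. *)
Lemma cycle_nbr_avoiding (T : finType) (e : rel T) (C : seq T) (x z : T) :
  simple_graph e -> k_connected 2 e -> induced_free P4 e -> max_cycle e C ->
  1 < size C -> x \notin C -> z \in C ->
  exists2 v, v \in C & (v != z) && e v x.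
Proof.
move=> e_simple [_ conn] free C_max C2 xC zC.
have [sym irr] := e_simple; have := C_max.1 => /andP[_ C_uniq].
have [c cC cz] : exists2 c, c \in C & c != z.
  apply/hasP; apply: contraLR C2; rewrite -all_predC -leqNgt => /allP allz.
  apply: (@uniq_leq_size _ C [:: z]) => // c /allz /=.
  by rewrite inE negbK.
have xz : x \notin [set z] by rewrite inE; apply: contraNneq xC => ->.
have cz' : c \notin [set z] by rewrite inE.
have z_small : #|[set z]| < 2 by rewrite cards1.
have /connectP[p p_path c_last] := conn _ z_small _ _ xz cz'.
elim: p x xC {xz} p_path c_last => [|u p IHp] x xC /=.
  by move=> _ cx; rewrite -cx cC in xC.
case/andP=> /and3P[_]; rewrite inE => uz xu p_path c_last.
case: (boolP (u \in C)) => uC; first by exists u; rewrite // uz sym.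
have [v vC /andP[vz vu]] := IHp u uC p_path c_last.
exists v; rewrite // vz /=.
by apply: (off_cycle_nbr e_simple free C_max C2 uC xC); rewrite // sym.
Qed.

(** The centre of [W] is [w] if [w] is adjacent to [v1], and [v] otherwise. *)
Lemma two_attachments (T : finType) (e : rel T) (v v1 v2 w w1 w2 x y : T)
    (s t : seq T) :
  simple_graph e -> induced_free P4 e ->
  max_cycle e ([:: v; v1; v2] ++ s ++ [:: w; w1; w2] ++ t) ->
  x \notin [:: v; v1; v2] ++ s ++ [:: w; w1; w2] ++ t ->
  y \notin [:: v; v1; v2] ++ s ++ [:: w; w1; w2] ++ t ->
  e x y -> e v x -> e v y -> e w x -> e w y -> has_induced W e.
Proof.
move=> e_simple free C_max xC yC xy vx vy wx wy.
have [sym irr] := e_simple.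
have yx : e y x by rewrite sym.
have sw a b : ~~ e a b -> ~~ e b a by rewrite sym.
(* Rotating by [i] starts the cycle at [w], so that facts about the successors of [v] transfer to
   those of [w]. *)
pose i := size ([:: v; v1; v2] ++ s).
have C'_max := max_cycle_rot i C_max.
move: (xC) (yC); rewrite -!(mem_rot i (_ ++ _ ++ _)).
move: C'_max; rewrite catA rot_size_cat -!catA => C'_max xC' yC'.
have [vv1 v1v2] : e v v1 /\ e v1 v2.
  by case: C_max => /andP[/= /and3P[]].
have [ww1 w1w2] : e w w1 /\ e w1 w2.
  by case: C'_max => /andP[/= /and3P[]].
have v1x := next_nonadj sym C_max xC vx.
have v1y := next_nonadj sym C_max yC vy.
have v2x := next2_nonadj sym irr C_max xC yC xy vy.
have v2y := next2_nonadj sym irr C_max yC xC yx vx.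
have w1x := next_nonadj sym C'_max xC' wx.
have w1y := next_nonadj sym C'_max yC' wy.
have w2x := next2_nonadj sym irr C'_max xC' yC' xy wy.
have w2y := next2_nonadj sym irr C'_max yC' xC' yx wx.
have v1w1 : ~~ e v1 w1.
  exact: (@cross_nonadj _ _ v w v1 w1 x y [::] [::] (v2 :: s) (w2 :: t)).
have v1w2 : ~~ e v1 w2.
  exact: (@cross_nonadj _ _ v w v1 w2 x y [::] [:: w1] (v2 :: s) t).
have v2w1 : ~~ e v2 w1.
  exact: (@cross_nonadj _ _ v w v2 w1 x y [:: v1] [::] s (w2 :: t)).
(* Rerouting through [v2 w2] would lose both [v1] and [w1] and gain nothing; instead, [v1 v2 w2 w1]
   would be an induced P4. *)
have v2w2 : ~~ e v2 w2.
  apply/negP => v2w2; have w2w1 : e w2 w1 by rewrite sym.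
  by have := P4_free_path e_simple free v1v2 v2w2 w2w1 v1w2 v2w1; apply/negP.
(* Otherwise [x u a b] is an induced P4. *)
have next2_adj u a b : e u x -> e u a -> e a b -> ~~ e a x -> ~~ e b x -> e u b.
  move=> ux ua ab ax bx; apply/negPn/negP => ub; rewrite sym in ux.
  have := P4_free_path e_simple free ux ua ab (sw _ _ ax) ub.
  by apply/negP; apply: sw.
have vv2 := next2_adj _ _ _ vx vv1 v1v2 v1x v2x.
have ww2 := next2_adj _ _ _ wx ww1 w1w2 w1x w2x.
have w_center : e w v1 -> has_induced W e.
  move=> wv1; have wv2 := next2_adj _ _ _ wx wv1 v1v2 v1x v2x.
  apply: (@W_induced _ _ w x y v1 v2 w1 w2) => //=; rewrite ?negb_or ?andbT.
  - by rewrite wx wy wv1 wv2 ww1.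
  - by apply/and4P; split; apply: sw.
  - by apply/and4P; split; apply: sw.
  - by apply/andP.
  - by apply/andP.
case: (boolP (e w v1)) => [/w_center //|wv1].
(* If [v] missed [w1], then [v x w w1] would force the edge [v w], after which [v1 v w w1] would be
   an induced P4. *)
have vw1 : e v w1.
  apply/negPn/negP => vw1; have xw : e x w by rewrite sym.
  have vw : e v w.
    apply/negPn/negP => vw.
    have := P4_free_path e_simple free vx xw ww1 vw (sw _ _ w1x).
    exact/negP.
  have v1v : e v1 v by rewrite sym.
  have := P4_free_path e_simple free v1v vw ww1 (sw _ _ wv1) vw1.
  exact/negP.
have vw2 := next2_adj _ _ _ vx vw1 w1w2 w1x w2x.
apply: (@W_induced _ _ v x y v1 v2 w1 w2) => //=; rewrite ?negb_or ?andbT.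
- by rewrite vx vy vv1 vv2 vw1.
- by apply/and4P; split; apply: sw.
- by apply/and4P; split; apply: sw.
- by apply/andP.
- by apply/andP.
Qed.

(** Neither the first nor the second successor of [v] is adjacent to [x], so [w] is neither of
    them. *)
Lemma attachment_split (T : finType) (e : rel T) (v w x y : T) (p q : seq T) :
  symmetric e -> irreflexive e -> max_cycle e (v :: p ++ w :: q) ->
  x \notin v :: p ++ w :: q -> y \notin v :: p ++ w :: q ->
  e x y -> e v x -> e v y -> e w x ->
  exists v1 v2 s, p = [:: v1, v2 & s].
Proof.
move=> sym irr C_max xC yC xy vx vy wx.
case: p C_max xC yC => [|v1 [|v2 s]] C_max xC yC; last by exists v1, v2, s.
- by move: wx; rewrite (negPf (next_nonadj sym C_max xC vx)).
- by move: wx; rewrite (negPf (next2_nonadj sym irr C_max xC yC xy vy)).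
Qed.

Theorem theorem4 (T : finType) (e : rel T)
    (e_simple : simple_graph e)
    (e_2conn : k_connected 2 e)
    (e_P4free : induced_free P4 e)
    (e_Wfree : induced_free W e)
    (C : seq T) (C_longest : longest_cycle e C) :
  dominating_cycle e C.
Proof.
split=> [|x y xy]; first exact: C_longest.1.
case: (boolP (x \in C)) => xC; first by left.
case: (boolP (y \in C)) => yC; first by right.
case: e_Wfree; have [sym irr] := e_simple.
have C2 : 1 < size C by case: C_longest => -[/ltnW].
have C_max := longest_max_cycle C_longest.
have [c cC] : exists c, c \in C by case: (C) C2 => // c D _; exists c; rewrite mem_head.
have nbr z := @cycle_nbr_avoiding _ _ C x z e_simple e_2conn e_P4free C_max C2 xC.
(* The vertex [c] avoided here is arbitrary; avoiding [v] next yields a second attachment. *)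
have [v vC /andP[_ vx]] := nbr c cC.
have [w wC /andP[wv wx]] := nbr v vC.
have vy := off_cycle_nbr e_simple e_P4free C_max C2 xC yC xy vC vx.
have wy := off_cycle_nbr e_simple e_P4free C_max C2 xC yC xy wC wx.
have [i r rotC] := rot_to vC.
have := max_cycle_rot i C_max; move: xC yC wC.
rewrite -!(mem_rot i C) rotC [w \in _]inE (negPf wv) /= => xC yC wr.
case/splitPr: wr xC yC => {rotC} p q xC yC C'_max.
have [v1 [v2 [s ps]]] := attachment_split sym irr C'_max xC yC xy vx vy wx.
(* Seen from [w], the other arc [q] is split in the same way. *)
have C''_max := max_cycle_rot (size (v :: p)) C'_max.
move: (xC) (yC) C''_max; rewrite -!(mem_rot (size (v :: p)) (v :: p ++ w :: q)).
rewrite -cat_cons rot_size_cat cat_cons => xC' yC' C''_max.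
have [w1 [w2 [t qt]]] := attachment_split sym irr C''_max xC' yC' xy wx wy vx.
subst p q; exact: (two_attachments e_simple e_P4free C'_max xC yC).
Qed.
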